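(* Let $\vec{r}:[0,L]\to E^3$ be a unit speed Frenet curve with Frenet frame $\{\vec T,\vec N,\vec B\}$, curvature $\kappa$ and torsion $\tau$. Let $\vec{P}(s,t)=\vec{r}(s)+u(s,t)\vec{T}(s)+v(s,t)\vec{N}(s)+w(s,t)\vec{B}(s)$, $0\le s\le L$, $0\le t\le T$, be a regular surface with $u,v,w$ smooth, let $t_0\in[0,T]$, and write the unit surface normal as $\vec n(s,t_0)=\varphi_1(s,t_0)\vec T(s)+\varphi_2(s,t_0)\vec N(s)+\varphi_3(s,t_0)\vec B(s)$. Then $\vec r$ is a $D$-type curve on $\vec P$ (as the parameter curve $t=t_0$) if and only if there is a real constant $c$ such that for all $s\in[0,L]$ $$u(s,t_0)=v(s,t_0)=w(s,t_0)=0,$$ $$\varphi_1(s,t_0)=0,\qquad \varphi_2(s,t_0)=\pm\sqrt{1-\frac{c^2(\kappa^2+\tau^2)}{\kappa^2}},\qquad \varphi_3(s,t_0)=c\,\frac{\sqrt{\kappa^2+\tau^2}}{\kappa},$$ where $\kappa=\kappa(s)$, $\tau=\tau(s)$.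
   Context: $E^3$ is Euclidean 3-space. A Frenet curve is a regular curve with $\vec r''(s)\neq\vec 0$ for all $s$ ($s$ arc length), so $\kappa(s)>0$. Its Frenet frame is $\vec T=\vec r'$, $\vec N=\vec r''/\|\vec r''\|$, $\vec B=\vec T\times\vec N$, with $\vec T'=\kappa\vec N$, $\vec N'=-\kappa\vec T+\tau\vec B$, $\vec B'=-\tau\vec N$. The unit Darboux vector is $\vec W_0=\frac{\tau}{\sqrt{\kappa^2+\tau^2}}\vec T+\frac{\kappa}{\sqrt{\kappa^2+\tau^2}}\vec B$. A surface $\vec P(s,t)$ is regular if $\frac{\partial \vec P}{\partial s}\times\frac{\partial \vec P}{\partial t}\ne\vec 0$ everywhere; its unit normal is $\vec n=\frac{\partial_s\vec P\times\partial_t\vec P}{\|\partial_s\vec P\times\partial_t\vec P\|}$. The curve $\vec r$ is isoparametric on $\vec P$ (at $t_0$) if $\vec P(s,t_0)=\vec r(s)$ for all $s$. A unit speed isoparametric curve $\vec r$ on $\vec P$ is called a $D$-type curve on $\vec P$ if $\langle\vec n(s,t_0),\vec W_0(s)\rangle$ is constant in $s$. The symbol $\pm$ means that $\varphi_2$ equals the indicated square root up to sign. *)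

(* Defs.v *)
From HB Require Import structures.
From mathcomp Require Import all_boot all_order all_algebra.
From mathcomp Require Import all_classical all_reals all_analysis.

Set Implicit Arguments.
Unset Strict Implicit.
Unset Printing Implicit Defensive.

Import Order.TTheory GRing.Theory Num.Theory.
Import numFieldNormedType.Exports.

Local Open Scope classical_set_scope.
Local Open Scope ring_scope.

(* The library norm `|x| on 'rV[R]_3 is the sup norm, so the Euclidean one is
   defined here; both induce the same limits, hence the same derivatives. *)
Section Euclidean3.
Variable R : realType.
Implicit Types a b : 'rV[R]_3.

Definition dot a b : R := \sum_i a 0 i * b 0 i.

Definition enorm a : R := Num.sqrt (dot a a).

(* Indices are added modulo 3 (ring structure of 'I_3). *)
Definition cross a b : 'rV[R]_3 :=
  \row_(i < 3) (a 0 (i + 1) * b 0 (i + 2%:R) - a 0 (i + 2%:R) * b 0 (i + 1)).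

End Euclidean3.

(* Derivatives relative to a set A: only values of f on A are used, so at an
   endpoint of a closed interval this is the one-sided derivative. *)
Section DeriveWithin.
Variables (R : realType) (V : normedModType R).
Implicit Types (A B : set R).

Definition diff_quot (f : R -> V) (x y : R) : V := (y - x)^-1 *: (f y - f x).

Definition derivable_within A (f : R -> V) (x : R) : Prop :=
  cvg (diff_quot f x @ within A x^').

Definition derive_within A (f : R -> V) (x : R) : V :=
  lim (diff_quot f x @ within A x^').

Fixpoint C_within (n : nat) A (f : R -> V) : Prop :=
  match n with
  | 0 => {within A, continuous f}
  | m.+1 => (forall x, A x -> derivable_within A f x) /\
            C_within m A (derive_within A f)
  end.

Definition partial_s A (f : R -> R -> V) (s t : R) : V :=
  derive_within A (fun s' => f s' t) s.

Definition partial_t B (f : R -> R -> V) (s t : R) : V :=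
  derive_within B (f s) t.

Fixpoint C2_within (n : nat) A B (f : R -> R -> V) : Prop :=
  match n with
  | 0 => {within A `*` B, continuous (fun p : R * R => f p.1 p.2)}
  | m.+1 => [/\ forall s t, A s -> B t ->
                  derivable_within A (fun s' => f s' t) s /\
                  derivable_within B (f s) t,
                C2_within m A B (partial_s A f) &
                C2_within m A B (partial_t B f)]
  end.

Definition smooth2 A B (f : R -> R -> V) : Prop := forall n, C2_within n A B f.

End DeriveWithin.

Section FrenetCurve.
Variables (R : realType) (L : R) (r : R -> 'rV[R]_3).

Definition velocity : R -> 'rV[R]_3 := derive_within `[0, L] r.

Definition acceleration : R -> 'rV[R]_3 := derive_within `[0, L] velocity.

Definition unit_speed : Prop :=
  forall s, s \in `[0, L] -> enorm (velocity s) = 1.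

(* C^3 is what the existence of the torsion requires. *)
Definition Frenet_curve : Prop :=
  [/\ C_within 3 `[0, L] r,
      forall s, s \in `[0, L] -> velocity s != 0 &
      forall s, s \in `[0, L] -> acceleration s != 0].

(* The frame, curvature and torsion below are those of a unit speed curve. *)
Definition tangent : R -> 'rV[R]_3 := velocity.

Definition principal_normal (s : R) : 'rV[R]_3 :=
  (enorm (acceleration s))^-1 *: acceleration s.

Definition binormal (s : R) : 'rV[R]_3 := cross (tangent s) (principal_normal s).

(* T' = kappa N with N a unit vector and kappa > 0. *)
Definition curvature (s : R) : R := enorm (acceleration s).

(* The B-component of N' = - kappa T + tau B. *)
Definition torsion (s : R) : R :=
  dot (derive_within `[0, L] principal_normal s) (binormal s).

Definition darboux (s : R) : 'rV[R]_3 :=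
  let d := Num.sqrt (curvature s ^+ 2 + torsion s ^+ 2) in
  (torsion s / d) *: tangent s + (curvature s / d) *: binormal s.

Definition frame_surface (u v w : R -> R -> R) (s t : R) : 'rV[R]_3 :=
  r s + u s t *: tangent s + v s t *: principal_normal s + w s t *: binormal s.

End FrenetCurve.

Section Surface.
Variables (R : realType) (L T : R) (P : R -> R -> 'rV[R]_3).

Definition surface_cross (s t : R) : 'rV[R]_3 :=
  cross (partial_s `[0, L] P s t) (partial_t `[0, T] P s t).

Definition regular_surface : Prop :=
  forall s t, s \in `[0, L] -> t \in `[0, T] -> surface_cross s t != 0.

Definition unit_normal (s t : R) : 'rV[R]_3 :=
  (enorm (surface_cross s t))^-1 *: surface_cross s t.

Definition isoparametric (r : R -> 'rV[R]_3) (t0 : R) : Prop :=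
  forall s, s \in `[0, L] -> P s t0 = r s.

Definition D_type (r : R -> 'rV[R]_3) (t0 : R) : Prop :=
  [/\ unit_speed L r,
      isoparametric r t0 &
      exists c : R, forall s, s \in `[0, L] ->
        dot (unit_normal s t0) (darboux L r s) = c].

End Surface.

(* Main.v *)
Require Import Defs.
From HB Require Import structures.
From mathcomp Require Import all_boot all_order all_algebra.
From mathcomp Require Import all_classical all_reals all_analysis.
From mathcomp Require Import ring lra.

Set Implicit Arguments.
Unset Strict Implicit.
Unset Printing Implicit Defensive.

Import Order.TTheory GRing.Theory Num.Theory.
Import numFieldNormedType.Exports.

Local Open Scope classical_set_scope.
Local Open Scope ring_scope.

(** In an orthonormal frame [T], [N], [B] everything reduces to reading off
coordinates.  If [P(s,t0) = r(s)], the displacement [u T + v N + w B] vanishes,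
hence so do its coordinates, and the [s]-derivative of [P] along the parameter
curve is [T]; since the normal is a cross product with that derivative, its
[T]-coordinate [phi1] is zero ([unit_normal_orth_tangent]).  The Darboux vector
is [(tau T + kappa B) / sqrt (kappa^2 + tau^2)], so the angle condition then
says [phi3 kappa / sqrt (kappa^2 + tau^2) = c], which determines [phi3], while
[phi2^2 = 1 - phi3^2] because the normal is a unit vector.  Conversely, the
displayed values of [phi1] and [phi3] give back the inner product [c].

The analytic input is that the frame is orthonormal, that is, that the
acceleration of a unit speed curve is orthogonal to its velocity.  For unit
vectors, [<T(y) - T(s), T(s)> = - |T(y) - T(s)|^2 / 2]: dividing by [y - s] and
letting [y] tend to [s] gives zero on the right
([derive_within_unit_orth]).  All derivatives being relative to [[0, L]], the
limits are unique because no point of this interval is isolated. *)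

(** * Euclidean geometry of 3-space *)

Section Euclidean3.
Variable R : realType.
Implicit Types a b c : 'rV[R]_3.

Lemma sum_ord3 (F : 'I_3 -> R) : \sum_i F i = F 0 + F 1 + F 2%:R.
Proof.
rewrite !big_ord_recl big_ord0 addr0 addrA.
by congr (F _ + F _ + F _); apply/val_inj.
Qed.

Lemma dotE a b : dot a b = a 0 0 * b 0 0 + a 0 1 * b 0 1 + a 0 2%:R * b 0 2%:R.
Proof. by rewrite /dot sum_ord3. Qed.

Lemma crossE a b :
  [/\ cross a b 0 0 = a 0 1 * b 0 2%:R - a 0 2%:R * b 0 1,
      cross a b 0 1 = a 0 2%:R * b 0 0 - a 0 0 * b 0 2%:R &
      cross a b 0 2%:R = a 0 0 * b 0 1 - a 0 1 * b 0 0].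
Proof.
(* Indices live in Z/3, so 1 + 2 = 0 and 2 + 2 = 1. *)
have e11 : 1 + 1 = 2%:R :> 'I_3 by apply/val_inj.
have e12 : 1 + 2%:R = 0 :> 'I_3 by apply/val_inj.
have e21 : 2%:R + 1 = 0 :> 'I_3 by apply/val_inj.
have e22 : 2%:R + 2%:R = 1 :> 'I_3 by apply/val_inj.
by rewrite /cross !mxE !add0r e11 e12 e21 e22.
Qed.

Lemma dotC a b : dot a b = dot b a.
Proof. by rewrite !dotE; ring. Qed.

Lemma dotDl a b c : dot (a + b) c = dot a c + dot b c.
Proof. by rewrite !dotE !mxE; ring. Qed.

Lemma dotZl (k : R) a b : dot (k *: a) b = k * dot a b.
Proof. by rewrite !dotE !mxE; ring. Qed.

Lemma dotDr a b c : dot c (a + b) = dot c a + dot c b.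
Proof. by rewrite dotC dotDl !(dotC c). Qed.

Lemma dotZr (k : R) a b : dot b (k *: a) = k * dot b a.
Proof. by rewrite dotC dotZl (dotC b). Qed.

Lemma dotNl a b : dot (- a) b = - dot a b.
Proof. by rewrite -scaleN1r dotZl mulN1r. Qed.

Lemma dotNr a b : dot b (- a) = - dot b a.
Proof. by rewrite dotC dotNl (dotC b). Qed.

Lemma dot0v a : dot 0 a = 0.
Proof. by rewrite -(scale0r a) dotZl mul0r. Qed.

Lemma dotv0 a : dot a 0 = 0.
Proof. by rewrite dotC dot0v. Qed.

Lemma dot_crossl a b : dot a (cross a b) = 0.
Proof. by rewrite dotE; have [-> -> ->] := crossE a b; ring. Qed.

Lemma dot_crossr a b : dot b (cross a b) = 0.
Proof. by rewrite dotE; have [-> -> ->] := crossE a b; ring. Qed.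

Lemma lagrange_identity a b :
  dot (cross a b) (cross a b) = dot a a * dot b b - dot a b ^+ 2.
Proof. by rewrite !dotE; have [-> -> ->] := crossE a b; ring. Qed.

Lemma dot_ge0 a : 0 <= dot a a.
Proof. by apply: sumr_ge0 => i _; rewrite -expr2 sqr_ge0. Qed.

Lemma enorm_gt0 a : a != 0 -> 0 < enorm a.
Proof.
move=> a0; rewrite sqrtr_gt0 lt0r dot_ge0 andbT.
apply: contraNneq a0 => /eqP; rewrite psumr_eq0; last first.
  by move=> i _; rewrite -expr2 sqr_ge0.
move=> /allP a0; apply/eqP/rowP => i; rewrite mxE; apply/eqP.
by have := a0 i (mem_index_enum i); rewrite /= -expr2 sqrf_eq0.
Qed.

Lemma enorm1_dot a : enorm a = 1 -> dot a a = 1.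
Proof. by move=> a1; rewrite -(sqr_sqrtr (dot_ge0 a)) -/(enorm a) a1 expr1n. Qed.

Lemma dot_normalize a : a != 0 ->
  dot ((enorm a)^-1 *: a) ((enorm a)^-1 *: a) = 1.
Proof.
move=> /enorm_gt0 a0; rewrite dotZl dotZr -(sqr_sqrtr (dot_ge0 a)) -/(enorm a).
by field; rewrite gt_eqF.
Qed.

Definition orthonormal_frame a b c : Prop :=
  [/\ dot a a = 1, dot b b = 1 & dot c c = 1] /\
  [/\ dot a b = 0, dot a c = 0 & dot b c = 0].

Lemma orthonormal_frame_cross a b :
  dot a a = 1 -> dot b b = 1 -> dot a b = 0 ->
  orthonormal_frame a b (cross a b).
Proof.
move=> aa bb ab; split; split=> //; rewrite ?dot_crossl ?dot_crossr //.
by rewrite lagrange_identity aa bb ab; ring.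
Qed.

Lemma dot_frame a b c (x1 x2 x3 y1 y2 y3 : R) : orthonormal_frame a b c ->
  dot (x1 *: a + x2 *: b + x3 *: c) (y1 *: a + y2 *: b + y3 *: c) =
  x1 * y1 + x2 * y2 + x3 * y3.
Proof.
move=> [[aa bb cc] [ab ac bc]].
rewrite !(dotDl, dotDr) !(dotZl, dotZr) (dotC b a) (dotC c a) (dotC c b).
by rewrite aa bb cc ab ac bc; ring.
Qed.

Lemma dot_frame_first a b c (x1 x2 x3 : R) : orthonormal_frame a b c ->
  dot (x1 *: a + x2 *: b + x3 *: c) a = x1.
Proof.
move=> [[aa _ _] [ab ac _]].
by rewrite !dotDl !dotZl (dotC b) (dotC c) aa ab ac; ring.
Qed.

Lemma frame_coords0 a b c (x1 x2 x3 : R) : orthonormal_frame a b c ->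
  x1 *: a + x2 *: b + x3 *: c = 0 -> [/\ x1 = 0, x2 = 0 & x3 = 0].
Proof.
move=> fr x0.
have coord y1 y2 y3 : x1 * y1 + x2 * y2 + x3 * y3 = 0.
  by rewrite -(dot_frame _ _ _ y1 y2 y3 fr) x0 dot0v.
have c1 := coord 1 0 0; have c2 := coord 0 1 0; have c3 := coord 0 0 1.
by split; lra.
Qed.

Lemma cvg_dot (U : Type) (F : set_system U) (f g : U -> 'rV[R]_3) a b :
  Filter F -> f @ F --> a -> g @ F --> b -> (fun x => dot (f x) (g x)) @ F --> dot a b.
Proof.
move=> FF fa gb.
have coord (h : U -> 'rV[R]_3) c i : h @ F --> c -> h x 0 i @[x --> F] --> c 0 i.
  by move=> hc; apply: (cvg_comp h (fun d => d 0 i) hc); apply: coord_continuous.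
rewrite dotE; under eq_fun do rewrite dotE.
by apply: cvgD; [apply: cvgD|]; apply: cvgM; apply: coord.
Qed.

End Euclidean3.

(** * Derivatives relative to a set *)

Section DeriveWithin.
Variable R : realType.

(** This is what makes one-sided limits at the two endpoints meaningful; it
fails for a degenerate interval, hence [0 < L]. *)
Lemma within_itv_dnbhs_proper (L s : R) : 0 < L -> s \in `[0, L] ->
  ProperFilter (within `[0, L] s^').
Proof.
move=> L0; rewrite in_itv /= => /andP[s0 sL].
apply: Build_ProperFilter_ex => S /nbhs_ballP[e /= e0 Se].
have S_itv y : `|s - y| < e -> y != s -> 0 <= y <= L -> S y.
  by move=> ye ys yL; apply: (Se y) => //=; rewrite in_itv.
(* The witness near [s] lies to its right, except at the right endpoint. *)
have [sltL|] := ltP s L.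
  have [d [d0 de dL]] : exists d, [/\ 0 < d, d < e & d <= L - s].
    exists (Num.min (e / 2) (L - s)); split.
    - by rewrite lt_min; apply/andP; split; lra.
    - by rewrite gt_min; apply/orP; left; lra.
    - by rewrite ge_min lexx orbT.
  exists (s + d); apply: S_itv.
  - by rewrite opprD addNKr normrN gtr0_norm.
  - by apply/eqP => sd; lra.
  - by apply/andP; split; lra.
move=> Ls.
have [d [d0 de dL]] : exists d, [/\ 0 < d, d < e & d <= L].
  exists (Num.min (e / 2) L); split.
  - by rewrite lt_min; apply/andP; split; lra.
  - by rewrite gt_min; apply/orP; left; lra.
  - by rewrite ge_min lexx orbT.
exists (s - d); apply: S_itv.
- by rewrite opprB addrC subrK gtr0_norm.
- by apply/eqP => sd; lra.
- by apply/andP; split; lra.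
Qed.

Lemma eq_derive_within (V : normedModType R) (A : set R) (f g : R -> V) x :
  A x -> (forall y, A y -> f y = g y) ->
  derive_within A f x = derive_within A g x.
Proof.
move=> Ax fg; congr (lim _); apply/funext => S; apply/propext.
split; apply: (@filterS _ x^' _) => y /= + Ay => /(_ Ay);
  by rewrite /diff_quot !fg.
Qed.

(** Unit vectors [p], [q] satisfy [<p - q, q> = - |p - q|^2 / 2], so the inner
product of the difference quotient at [y] with [f x] is
[(x - y) / 2] times its squared length, which has a limit. *)
Lemma derive_within_unit_orth (A : set R) (f : R -> 'rV[R]_3) x :
  ProperFilter (within A x^') -> A x -> (forall y, A y -> dot (f y) (f y) = 1) ->
  derivable_within A f x -> dot (f x) (derive_within A f x) = 0.
Proof.
move=> PF Ax f1 df.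
have dqf : diff_quot f x y @[y --> within A x^'] --> derive_within A f x by [].
have lim_fdq : dot (f x) (diff_quot f x y) @[y --> within A x^'] -->
    dot (f x) (derive_within A f x).
  by apply: cvg_dot => //; apply: cvg_cst.
have lim_id : (y : R) @[y --> within A x^'] --> x.
  by move=> S /nbhs_dnbhs; exact: cvg_within.
have lim0 : (x - y) / 2 * dot (diff_quot f x y) (diff_quot f x y)
    @[y --> within A x^'] --> (0 : R).
  rewrite -[0](_ : (x - x) / 2 *
    dot (derive_within A f x) (derive_within A f x) = 0); last first.
    by rewrite subrr !mul0r.
  apply: cvgM; last exact: cvg_dot.
  by apply: cvgMr_tmp; apply: cvgB => //; apply: cvg_cst.
apply: (cvg_unique (@norm_hausdorff _ R) lim_fdq); apply: cvg_trans lim0.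
apply: near_eq_cvg; near=> y.
have Ay : A y by near: y; exact: withinT.
rewrite /diff_quot; have fy := f1 y Ay; have fx := f1 x Ax.
have [->|yx] := eqVneq y x; first by rewrite !subrr !scaler0 !dotv0 mulr0.
rewrite !(dotZl, dotZr, dotDl, dotDr, dotNl, dotNr) fy fx.
rewrite (dotC (f y)); field; by rewrite subr_eq0.
Unshelve. all: by end_near. Qed.

End DeriveWithin.

(** * The Frenet frame of a unit speed curve *)

Section Frenet.
Variables (R : realType) (L : R) (r : R -> 'rV[R]_3).

Lemma Frenet_frame_orthonormal s : 0 < L -> Frenet_curve L r -> unit_speed L r ->
  s \in `[0, L] ->
  orthonormal_frame (tangent L r s) (principal_normal L r s) (binormal L r s).
Proof.
move=> L0 [[_ [dv _]] _ a_neq0] r1 sL.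
apply: orthonormal_frame_cross.
- exact/enorm1_dot/r1.
- exact/dot_normalize/a_neq0.
- rewrite /principal_normal dotZr.
  have -> : dot (tangent L r s) (acceleration L r s) = 0; last by rewrite mulr0.
  apply: derive_within_unit_orth => //; first exact: within_itv_dnbhs_proper.
    by move=> y yL; apply/enorm1_dot/r1.
  exact: dv.
Qed.

Lemma curvature_gt0 s : Frenet_curve L r -> s \in `[0, L] -> 0 < curvature L r s.
Proof. by move=> [_ _ a_neq0] /a_neq0; apply: enorm_gt0. Qed.

(** * The surface normal along a parameter curve *)

Lemma unit_normal_unit (T : R) (P : R -> R -> 'rV[R]_3) s t :
  regular_surface L T P -> s \in `[0, L] -> t \in `[0, T] ->
  dot (unit_normal L T P s t) (unit_normal L T P s t) = 1.
Proof. by move=> regP sL tT; apply/dot_normalize/regP. Qed.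

(** Along the parameter curve the [s]-derivative of [P] is the tangent, and the
normal is proportional to a cross product having this derivative as a factor. *)
Lemma unit_normal_orth_tangent (T t0 : R) (P : R -> R -> 'rV[R]_3) s :
  isoparametric L P r t0 -> s \in `[0, L] ->
  dot (unit_normal L T P s t0) (tangent L r s) = 0.
Proof.
move=> iso sL; rewrite /unit_normal dotZl dotC /surface_cross.
have -> : partial_s `[0, L] P s t0 = tangent L r s.
  exact: eq_derive_within.
by rewrite dot_crossl mulr0.
Qed.

Lemma isoparametric_frame_surface (u v w : R -> R -> R) t0 :
  0 < L -> Frenet_curve L r -> unit_speed L r ->
  isoparametric L (frame_surface L r u v w) r t0 <->
  forall s, s \in `[0, L] -> [/\ u s t0 = 0, v s t0 = 0 & w s t0 = 0].
Proof.
move=> L0 FC r1; split=> [iso s sL|uvw0 s sL].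
  apply: (frame_coords0 (Frenet_frame_orthonormal L0 FC r1 sL)).
  by apply: (addrI (r s)); rewrite addr0 -[RHS]iso // /frame_surface !addrA.
by rewrite /frame_surface; have [-> -> ->] := uvw0 s sL; rewrite !scale0r !addr0.
Qed.

End Frenet.

(** * D-type curves *)

Theorem theorem3p1 (R : realType) (L T t0 : R) (r : R -> 'rV[R]_3)
    (u v w phi1 phi2 phi3 : R -> R -> R) :
  0 < L -> 0 < T -> t0 \in `[0, T] ->
  Frenet_curve L r -> unit_speed L r ->
  smooth2 `[0, L] `[0, T] u ->
  smooth2 `[0, L] `[0, T] v ->
  smooth2 `[0, L] `[0, T] w ->
  regular_surface L T (frame_surface L r u v w) ->
  (forall s, s \in `[0, L] ->
     unit_normal L T (frame_surface L r u v w) s t0 =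
       phi1 s t0 *: tangent L r s + phi2 s t0 *: principal_normal L r s
       + phi3 s t0 *: binormal L r s) ->
  D_type L T (frame_surface L r u v w) r t0 <->
  exists c : R, forall s, s \in `[0, L] ->
    let kappa := curvature L r s in
    let tau := torsion L r s in
    let X := 1 - c ^+ 2 * (kappa ^+ 2 + tau ^+ 2) / kappa ^+ 2 in
    [/\ [/\ u s t0 = 0, v s t0 = 0 & w s t0 = 0],
        phi1 s t0 = 0,
        0 <= X /\ (phi2 s t0 = Num.sqrt X \/ phi2 s t0 = - Num.sqrt X) &
        phi3 s t0 = c * (Num.sqrt (kappa ^+ 2 + tau ^+ 2) / kappa)].
Proof.
move=> L0 T0 t0T FC r1 _ _ _ regP nE.
have frame s (sL : s \in `[0, L]) := Frenet_frame_orthonormal L0 FC r1 sL.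
have n_darboux s : s \in `[0, L] ->
    dot (unit_normal L T (frame_surface L r u v w) s t0) (darboux L r s) =
    (phi1 s t0 * torsion L r s + phi3 s t0 * curvature L r s) /
      Num.sqrt (curvature L r s ^+ 2 + torsion L r s ^+ 2).
  move=> sL; set d := Num.sqrt _.
  have -> : darboux L r s = (torsion L r s / d) *: tangent L r s
      + 0 *: principal_normal L r s + (curvature L r s / d) *: binormal L r s.
    by rewrite scale0r addr0.
  by rewrite nE // dot_frame; [ring|exact: frame].
have norm_gt0 s : s \in `[0, L] ->
    0 < Num.sqrt (curvature L r s ^+ 2 + torsion L r s ^+ 2).
  by move=> sL; rewrite sqrtr_gt0 ltr_wpDr ?sqr_ge0// exprn_gt0// curvature_gt0.
split=> [[_ iso [c nc]]|[c H]].
  have uvw0 := (isoparametric_frame_surface u v w t0 L0 FC r1).1 iso.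
  exists c => s sL kappa tau X.
  have kappa0 : 0 < kappa by exact: curvature_gt0.
  have phi1_0 : phi1 s t0 = 0.
    rewrite -(unit_normal_orth_tangent T iso sL) nE //.
    by rewrite (dot_frame_first _ _ _ (frame s sL)).
  have phi3E : phi3 s t0 = c * (Num.sqrt (kappa ^+ 2 + tau ^+ 2) / kappa).
    have := nc s sL; rewrite n_darboux // phi1_0 mul0r add0r => <-.
    by rewrite -/kappa -/tau; field; rewrite !gt_eqF //; apply: norm_gt0.
  (* The sign condition on [X] comes for free, [X] being a square. *)
  have phi2E : phi2 s t0 ^+ 2 = X.
    have := unit_normal_unit regP sL t0T.
    rewrite nE // dot_frame; last exact: frame.
    rewrite phi1_0 phi3E mul0r add0r -!expr2 !exprMn exprVn sqr_sqrtr.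
      by move=> /(canRL (addrK _)) ->; rewrite mulrA.
    by rewrite addr_ge0 ?sqr_ge0.
  split=> //; first exact: uvw0.
  rewrite -phi2E sqr_ge0 sqrtr_sqr; split=> //.
  by case: (ger0P (phi2 s t0)) => _; [left|right; rewrite opprK].
split=> //.
  by apply/isoparametric_frame_surface => // s /H[].
exists c => s sL; have [_ phi1_0 _ phi3E] := H s sL.
rewrite n_darboux // phi1_0 phi3E mul0r add0r.
by field; rewrite !gt_eqF ?norm_gt0 // curvature_gt0.
Qed.
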